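(* Let $A=\begin{bmatrix} a & b\\ c& d\end{bmatrix}$ be a $2\times 2$ matrix with entries in the quaternions $\mathbb{H}$, with $b\neq 0$. Let $\mu\colon\mathbb{H}\to\mathbb{H}$ be the map $\mu(\lambda)=c-(d-\lambda)b^{-1}(a-\lambda)$, and let $\lambda\in\mathbb{H}$ be a left eigenvalue of $A$. If the differential $\mu_{*\lambda}$ has rank $4$, then $A$ has exactly two different left eigenvalues.
   Context: $\mathbb{H}$ denotes the quaternions, identified as a manifold with $\mathbb{R}^4$. A quaternion $\lambda$ is a left eigenvalue of a square quaternionic matrix $A$ if $A-\lambda\,\mathrm{Id}$ is not invertible. For $b\ne 0$, the left eigenvalues of the $2\times2$ quaternionic matrix $A=\begin{bmatrix} a & b\\ c& d\end{bmatrix}$ are exactly the zeros of the map $\mu(\lambda)=c-(d-\lambda)b^{-1}(a-\lambda)$. The differential of $\mu$ at $\lambda$ is the $\mathbb{R}$-linear map $\mu_{*\lambda}\colon\mathbb{H}\to\mathbb{H}$, $\mu_{*\lambda}(X)=Xb^{-1}(a-\lambda)+(d-\lambda)b^{-1}X$; its rank is its rank as a real linear map. *)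

(* Defs.v *)
From HB Require Import structures.
From mathcomp Require Import all_boot all_order all_algebra.
From mathcomp Require Import all_classical all_reals all_analysis.
From mathcomp Require Import ring lra.

Set Implicit Arguments.
Unset Strict Implicit.
Unset Printing Implicit Defensive.

Import Order.TTheory GRing.Theory Num.Theory.
Import numFieldNormedType.Exports.
Local Open Scope classical_set_scope.
Local Open Scope ring_scope.

(* The quaternion x0 + x1 i + x2 j + x3 k is the row vector (x0, x1, x2, x3);
   the alias keeps the topology, norm and R-module structure of R^4, and
   carries in addition the (noncommutative) division ring structure. *)
Definition quat (R : realType) : Type := 'rV[R]_4.

HB.instance Definition _ (R : realType) :=
  NormedModule.copy (quat R) 'rV[R]_4.

Section Quaternion.
Variable R : realType.
Implicit Types x y z : quat R.

Definition mkquat (x0 x1 x2 x3 : R) : quat R :=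
  \row_(i < 4) [:: x0; x1; x2; x3]`_i.

Definition qcoord (x : quat R) (i : 'I_4) : R := (x : 'rV[R]_4) 0 i.

Local Notation "x .[0]" := (qcoord x (@Ordinal 4 0 isT)) (at level 2).
Local Notation "x .[1]" := (qcoord x (@Ordinal 4 1 isT)) (at level 2).
Local Notation "x .[2]" := (qcoord x (@Ordinal 4 2 isT)) (at level 2).
Local Notation "x .[3]" := (qcoord x (@Ordinal 4 3 isT)) (at level 2).

Definition oneq : quat R := mkquat 1 0 0 0.

Definition mulq x y : quat R := mkquat
  (x.[0] * y.[0] - x.[1] * y.[1] - x.[2] * y.[2] - x.[3] * y.[3])
  (x.[0] * y.[1] + x.[1] * y.[0] + x.[2] * y.[3] - x.[3] * y.[2])
  (x.[0] * y.[2] - x.[1] * y.[3] + x.[2] * y.[0] + x.[3] * y.[1])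
  (x.[0] * y.[3] + x.[1] * y.[2] - x.[2] * y.[1] + x.[3] * y.[0]).

Definition conjq x : quat R := mkquat x.[0] (- x.[1]) (- x.[2]) (- x.[3]).

Definition sqnormq x : R :=
  x.[0] ^+ 2 + x.[1] ^+ 2 + x.[2] ^+ 2 + x.[3] ^+ 2.

Definition invq x : quat R := (sqnormq x)^-1 *: conjq x.

Lemma quatP x y : x.[0] = y.[0] -> x.[1] = y.[1] -> x.[2] = y.[2] ->
  x.[3] = y.[3] -> x = y.
Proof.
move=> h0 h1 h2 h3; apply/rowP => -[[|[|[|[|//]]]] p];
  [move: h0|move: h1|move: h2|move: h3]; rewrite /qcoord => h;
  by rewrite (bool_irrelevance p isT).
Qed.

Lemma mkquatE (x0 x1 x2 x3 : R) :
  (((mkquat x0 x1 x2 x3).[0] = x0) * ((mkquat x0 x1 x2 x3).[1] = x1) *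
   ((mkquat x0 x1 x2 x3).[2] = x2) * ((mkquat x0 x1 x2 x3).[3] = x3))%type.
Proof. by rewrite /qcoord /mkquat !mxE. Qed.

Lemma qcoord0 i : qcoord 0 i = 0.
Proof. exact: mxE. Qed.

Lemma qcoordD x y i : qcoord (x + y) i = qcoord x i + qcoord y i.
Proof. exact: mxE. Qed.

Lemma qcoordZ k x i : qcoord (k *: x) i = k * qcoord x i.
Proof. exact: mxE. Qed.

Let qE := (mkquatE, qcoordD, qcoordZ, qcoord0).

Lemma mulqA : associative mulq.
Proof. by move=> x y z; apply: quatP; rewrite !qE; ring. Qed.

Lemma mul1q : left_id oneq mulq.
Proof. by move=> x; apply: quatP; rewrite !qE; ring. Qed.

Lemma mulq1 : right_id oneq mulq.
Proof. by move=> x; apply: quatP; rewrite !qE; ring. Qed.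

Lemma mulqDl : left_distributive mulq +%R.
Proof. by move=> x y z; apply: quatP; rewrite !qE; ring. Qed.

Lemma mulqDr : right_distributive mulq +%R.
Proof. by move=> x y z; apply: quatP; rewrite !qE; ring. Qed.

Lemma oneq_neq0 : oneq != 0.
Proof.
apply/eqP => /(congr1 (fun x => x.[0])); rewrite !qE => /eqP.
by rewrite oner_eq0.
Qed.

HB.instance Definition _ := GRing.Zmodule_isNzRing.Build (quat R)
  mulqA mul1q mulq1 mulqDl mulqDr oneq_neq0.

Lemma scalerqAl (k : R) x y : k *: (x * y) = k *: x * y.
Proof. by apply: quatP; rewrite !qE; ring. Qed.

Lemma scalerqAr (k : R) x y : k *: (x * y) = x * (k *: y).
Proof. by apply: quatP; rewrite !qE; ring. Qed.

HB.instance Definition _ := GRing.Lmodule_isLalgebra.Build R (quat R) scalerqAl.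
HB.instance Definition _ := GRing.Lalgebra_isAlgebra.Build R (quat R) scalerqAr.

Lemma sqnormq_eq0 x : (sqnormq x == 0) = (x == 0).
Proof.
apply/eqP/eqP => [|->]; last by rewrite /sqnormq !qE; ring.
by rewrite /sqnormq => h; apply: quatP; rewrite qE; apply/eqP;
  rewrite -sqrf_eq0; apply/eqP; nra.
Qed.

Lemma mulVq : {in [pred x : quat R | x != 0], left_inverse 1 invq *%R}.
Proof.
move=> x; rewrite inE -sqnormq_eq0 => nx.
by apply: quatP; rewrite !qE; move: nx; rewrite /sqnormq => nx; field.
Qed.

Lemma mulqV : {in [pred x : quat R | x != 0], right_inverse 1 invq *%R}.
Proof.
move=> x; rewrite inE -sqnormq_eq0 => nx.
by apply: quatP; rewrite !qE; move: nx; rewrite /sqnormq => nx; field.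
Qed.

Lemma unitq x y : y * x = 1 /\ x * y = 1 -> x != 0.
Proof.
by case=> + _; apply: contra_eq_neq => ->; rewrite mulr0 eq_sym oner_neq0.
Qed.

Lemma invq0 : {in [predC [pred x : quat R | x != 0]], invq =1 id}.
Proof.
move=> x; rewrite !inE negbK => /eqP ->.
by apply: quatP; rewrite !qE; ring.
Qed.

HB.instance Definition _ := GRing.NzRing_hasMulInverse.Build (quat R)
  mulVq mulqV unitq invq0.

End Quaternion.

(* [unitmx] is only available over commutative rings. *)
Definition mx_invertible (R : pzRingType) (n : nat) (A : 'M[R]_n) : Prop :=
  exists B : 'M[R]_n, A *m B = 1%:M /\ B *m A = 1%:M.

Definition left_eigenvalue (R : realType) (n : nat) (A : 'M[quat R]_n)
    (l : quat R) : Prop :=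
  ~ mx_invertible (A - l%:M).

Definition mx22 (R : Type) (a b c d : R) : 'M[R]_2 :=
  \matrix_(i < 2, j < 2)
    if i == 0 then (if j == 0 then a else b) else (if j == 0 then c else d).

Definition mu (R : realType) (a b c d : quat R) (l : quat R) : quat R :=
  c - (d - l) * b^-1 * (a - l).

(* Rank over R of the Frechet differential of f : R^4 -> R^4 at x. *)
Definition diff_rank (R : realType) (f : quat R -> quat R) (x : quat R) : nat :=
  \rank (jacobian (f : 'rV[R]_4 -> 'rV[R]_4) x).

(* Main.v *)
Require Import Defs.
From HB Require Import structures.
From mathcomp Require Import all_boot all_order all_algebra.
From mathcomp Require Import all_classical all_reals all_analysis.
From mathcomp Require Import ring lra.
Set Implicit Arguments.
Unset Strict Implicit.
Unset Printing Implicit Defensive.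
Import GRing.Theory Num.Theory.
Import Order.TTheory numFieldNormedType.Exports.
Local Open Scope classical_set_scope.
Local Open Scope ring_scope.

(** Write x = l + y. Since mu l = 0, expanding gives
      mu (l + y) = (p y + y q) - y b^-1 y,
    with p = (d - l) b^-1 and q = b^-1 (a - l), and the linear part
    y |-> p y + y q is the differential of mu at l. So the eigenvalues other
    than l correspond to the y != 0 that make this expression vanish.

    The key is the substitution z = y^-1: multiplying by y^-1 on both sides
    turns the quadratic equation into the linear Sylvester equation
      q z + z p = b^-1,
    in which p and q have changed places ([quadratic_eq_inv]). The same
    substitution exchanges the nonzero kernel vectors of y |-> p y + y q and of
    z |-> q z + z p, so if the first map is injective, as rank 4 says, then so
    is the second ([sylv_swap_inj]). An injective endomorphism of R^4 is
    bijective, hence the Sylvester equation has exactly one solution z. It is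
    nonzero because b^-1 is, and l + z^-1 is the one further eigenvalue.

    Two links to the formal notions remain: left eigenvalues are the zeros of
    mu, by invertibility of a Schur complement ([mx22_invertibleP]), and the
    Frechet differential of mu is the expected one ([diff_mu]). *)

(** * Invertibility of 2 x 2 matrices over a noncommutative ring *)

Lemma mx22_eta (T : Type) (M : 'M[T]_2) :
  M = mx22 (M ord0 ord0) (M ord0 ord_max) (M ord_max ord0) (M ord_max ord_max).
Proof.
by apply/matrixP => -[[|[|//]] p] [[|[|//]] q]; rewrite mxE /=; congr (M _ _);
  apply: val_inj.
Qed.

Lemma mul_mx22 (S : pzRingType) (a b c d e f g h : S) :
  mx22 a b c d *m mx22 e f g h =
  mx22 (a * e + b * g) (a * f + b * h) (c * e + d * g) (c * f + d * h).
Proof.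
by apply/matrixP => -[[|[|//]] p] [[|[|//]] q];
  rewrite !mxE !big_ord_recl big_ord0 !mxE /= addr0.
Qed.

Lemma scalar_mx22 (S : pzRingType) (x : S) : x%:M = mx22 x 0 0 x.
Proof. by apply/matrixP => -[[|[|//]] p] [[|[|//]] q]; rewrite !mxE. Qed.

Lemma sub_mx22_scalar (S : pzRingType) (a b c d x : S) :
  mx22 a b c d - x%:M = mx22 (a - x) b c (d - x).
Proof.
rewrite scalar_mx22; apply/matrixP => -[[|[|//]] p] [[|[|//]] q];
  by rewrite !mxE ?subr0.
Qed.

Lemma mx22_inj (T : Type) (a b c d e f g h : T) :
  mx22 a b c d = mx22 e f g h -> [/\ a = e, b = f, c = g & d = h].
Proof.
move=> /matrixP E; move: (E ord0 ord0) (E ord0 ord_max) (E ord_max ord0)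
  (E ord_max ord_max); by rewrite !mxE.
Qed.

(** The element on the right is the Schur complement of b. If the matrix has an
    inverse, the upper right entry of that inverse is the inverse of the Schur
    complement; conversely a two-sided inverse is written out from it. *)
Lemma mx22_invertibleP (S : unitRingType) (a b c d : S) :
  b \is a GRing.unit ->
  mx_invertible (mx22 a b c d) <-> c - d * b^-1 * a \is a GRing.unit.
Proof.
move=> ub; split.
  move=> [B []]; rewrite (mx22_eta B).
  move: (B ord0 ord0) (B ord0 ord_max) (B ord_max ord0) (B ord_max ord_max).
  move=> e f g h.
  rewrite !mul_mx22 !scalar_mx22.
  move=> /(@mx22_inj S) [_ E2 _ E4] /(@mx22_inj S) [E5 E6 _ _].
  (* Substituting e in E5 and h in E4 shows that f inverts the complement. *)
  have he : e = - (f * d * b^-1).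
    by apply: (mulIr ub); rewrite mulNr divrK //; apply/eqP; rewrite -addr_eq0 E6.
  have hh : h = - (b^-1 * a * f).
    apply: (mulrI ub); rewrite mulrN !mulrA mulrV // mul1r.
    by apply/eqP; rewrite -addr_eq0 addrC E2.
  apply/unitrP; exists f; split.
    by rewrite mulrBr !mulrA addrC -mulNr -he.
  by rewrite mulrBl -E4 hh mulrN !mulrA.
move=> us; set s := c - _ in us.
have -> : c = s + d * b^-1 * a by rewrite subrK.
exists (mx22 (- (s^-1 * d * b^-1)) s^-1
  (b^-1 + b^-1 * a * s^-1 * d * b^-1) (- (b^-1 * a * s^-1))).
move: s us => s us.
rewrite !mul_mx22 !scalar_mx22; split; congr mx22;
  rewrite ?mulrDr ?mulrDl ?mulrN ?mulNr ?mulrA ?mulrV // ?mulVr // ?mul1r.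
- by rewrite addrC addrK.
- by rewrite subrr.
- by rewrite -opprD addNr.
- by rewrite addrK.
- by rewrite addrC addrK.
- by rewrite divrK // addNr.
- by rewrite divrK // -opprD subrr.
- by rewrite divrK // addrK.
Qed.

Lemma unitqE (R : realType) (x : quat R) : (x \is a GRing.unit) = (x != 0).
Proof. by []. Qed.

Lemma left_eigenvalue_mu (R : realType) (a b c d l : quat R) : b != 0 ->
  left_eigenvalue (mx22 a b c d) l <-> mu a b c d l = 0.
Proof.
move=> b0; rewrite /left_eigenvalue sub_mx22_scalar mx22_invertibleP ?unitqE //.
rewrite -/(mu a b c d l); split=> [/negP|->]; first by rewrite negbK => /eqP.
by rewrite eqxx.
Qed.

(** * Linear algebra and a criterion for the differential *)

Lemma endo_inj_surj (F : fieldType) (n : nat)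
    (f : {linear 'rV[F]_n -> 'rV[F]_n}) :
  (forall u, f u = 0 -> u = 0) -> forall v, exists u, f u = v.
Proof.
move=> finj v.
have ffree : row_free (lin1_mx f).
  rewrite -kermx_eq0; apply/eqP/row_matrixP => i; rewrite row0.
  by apply: finj; rewrite -mul_rV_lin1 -row_mul mulmx_ker row0.
have : (v <= lin1_mx f)%MS by rewrite submx_full // row_full_unit -row_free_unit.
by move=> /submxP [u ->]; exists u; rewrite mul_rV_lin1.
Qed.

Lemma endo_rank_inj (F : fieldType) (n : nat)
    (f : {linear 'rV[F]_n -> 'rV[F]_n}) :
  \rank (lin1_mx f) = n -> forall u, f u = 0 -> u = 0.
Proof.
move=> /eqP ffree u fu.
by apply: (row_free_inj ffree); rewrite mul_rV_lin1 fu mul0mx.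
Qed.

(** The first bound makes the linear map continuous, the second makes the
    remainder negligible; uniqueness of the differential does the rest. *)
Lemma diff_quadratic_remainder (R : realType) (V W : normedModType R)
    (f : V -> W) (df : {linear V -> W}) (x : V) (C K : R) :
  (forall h, `|df h| <= C * `|h|) ->
  (forall h, `|f (h + x) - (f x + df h)| <= K * `|h| ^+ 2) ->
  'd f x = df :> (V -> W).
Proof.
move=> dfC fK; apply: diff_unique.
  apply: bounded_linear_continuous; apply/linear_boundedP.
  exists C; split; first exact: num_real.
  by move=> r /ltW Cr h; apply: le_trans (dfC h) _; apply: ler_wpM2r.
apply/eqaddoP => e e0; near=> h.
apply: (le_trans (fK h)).
rewrite expr2 mulrA ler_wpM2r //.
(* K may be zero or negative, hence the denominator `|K| + 1. *)
have : `|h| <= e / (`|K| + 1).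
  near: h; apply/nbhs_norm0P; exists (e / (`|K| + 1)) => /=.
    by rewrite divr_gt0 // ltr_wpDl.
  by move=> y /=; exact: ltW.
rewrite ler_pdivlMr ?ltr_wpDl // => he.
apply: le_trans he; rewrite mulrC ler_wpM2l //.
by rewrite ler_wpDr // ler_norm.
Unshelve. all: by end_near. Qed.

(** * The differential of mu *)

Lemma qcoord_le (R : realType) (x : quat R) i : `|qcoord x i| <= `|x|.
Proof.
have -> : `|x| = mx_norm (x : 'rV[R]_4) by [].
rewrite mx_normrE.
exact: (le_bigmax _ (fun ij : 'I_1 * 'I_4 => `|(x : 'rV[R]_4) ij.1 ij.2|) (0, i)).
Qed.

(** The norm is the maximum of the coordinates, and each coordinate of a product
    is a signed sum of 4 products of coordinates: hence the factor 4. *)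
Lemma norm_mulq_le (R : realType) (x y : quat R) : `|x * y| <= 4 * `|x| * `|y|.
Proof.
have -> : `|x * y| = mx_norm (x * y : 'rV[R]_4) by [].
rewrite mx_normrE; apply/bigmax_leP; split; first by rewrite !mulr_ge0.
have xy i j : `|qcoord x i * qcoord y j| <= `|x| * `|y|.
  by rewrite normrM ler_pM // qcoord_le.
have D (s t u v : R) : `|s| <= `|x| * `|y| -> `|t| <= `|x| * `|y| ->
    `|u| <= `|x| * `|y| -> `|v| <= `|x| * `|y| ->
    `|s + t + u + v| <= 4 * `|x| * `|y|.
  move=> hs ht hu hv; apply: le_trans (ler_normD _ _) _.
  apply: le_trans (lerD (ler_normD _ _) (lexx _)) _.
  apply: le_trans (lerD (lerD (ler_normD _ _) (lexx _)) (lexx _)) _.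
  by lra.
move=> [r [[|[|[|[|//]]]] p]] _; rewrite mxE /=; apply: D; rewrite ?normrN; exact: xy.
Qed.

Definition sylv (A : pzRingType) (p q z : A) : A := p * z + z * q.

Lemma sylv_is_linear (K : pzRingType) (A : algType K) (p q : A) :
  linear (sylv p q).
Proof.
move=> k u v; rewrite /sylv mulrDr mulrDl scalerDr -scalerAl -scalerAr.
by rewrite addrACA.
Qed.

HB.instance Definition _ (K : pzRingType) (A : algType K) (p q : A) :=
  GRing.isLinear.Build K A A _ (sylv p q) (sylv_is_linear p q).

Lemma muD (R : realType) (a b c d l y : quat R) :
  mu a b c d (y + l) =
  mu a b c d l + sylv ((d - l) * b^-1) (b^-1 * (a - l)) y - y * b^-1 * y.
Proof.
rewrite /mu /sylv.
have -> : d - (y + l) = (d - l) - y by rewrite opprD addrCA addrC.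
have -> : a - (y + l) = (a - l) - y by rewrite opprD addrCA addrC.
move: (d - l) (a - l) (b^-1) => s t u.
by rewrite !mulrBl !mulrBr !mulrA !opprD !opprK !addrA.
Qed.

Lemma diff_mu (R : realType) (a b c d l : quat R) :
  'd (mu a b c d : 'rV[R]_4 -> 'rV[R]_4) (l : 'rV[R]_4) =
  sylv ((d - l) * b^-1) (b^-1 * (a - l)) :> ('rV[R]_4 -> 'rV[R]_4).
Proof.
set p := (d - l) * b^-1; set q := b^-1 * (a - l).
pose f : {linear 'rV[R]_4 -> 'rV[R]_4} :=
  (sylv p q : {linear quat R -> quat R}).
apply: (@diff_quadratic_remainder R 'rV[R]_4 'rV[R]_4 _ f _
  (4 * `|p| + 4 * `|q|) (16 * `|b^-1|)) => y.
  change (`|p * (y : quat R) + (y : quat R) * q| <=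
    (4 * `|p| + 4 * `|q|) * `|y : quat R|).
  apply: le_trans (ler_normD _ _) _; rewrite mulrDl lerD ?norm_mulq_le //.
  by rewrite mulrAC; exact: norm_mulq_le.
(* The remainder is exactly the quadratic term. *)
have -> : mu a b c d (y + l) - (mu a b c d l + f y) =
    - ((y : quat R) * b^-1 * (y : quat R)).
  rewrite -[RHS](addKr (mu a b c d l + f y)) addrC; congr (_ + _).
  exact: (muD a b c d l y).
rewrite normrN; apply: le_trans (norm_mulq_le _ _) _.
have h : `|(y : quat R) * b^-1| <= 4 * `|y| * `|b^-1| := norm_mulq_le _ _.
rewrite expr2 mulrA; apply: ler_wpM2r; first exact: normr_ge0.
have -> : 16 * `|b^-1| * `|y| = 4 * (4 * `|y| * `|b^-1|) by ring.
by rewrite ler_wpM2l.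
Qed.

(** * Passing to inverses *)

Lemma sylv_inv (A : unitRingType) (p q y : A) : y \is a GRing.unit ->
  sylv q p y^-1 = y^-1 * sylv p q y * y^-1.
Proof.
by move=> uy; rewrite /sylv mulrDr mulrDl !mulrA mulVr // mul1r mulrK // addrC.
Qed.

(** A nonzero kernel vector z of the second map would give the kernel vector
    z^-1 of the first, by [sylv_inv]. *)
Lemma sylv_swap_inj (R : realType) (p q : quat R) :
  (forall y, sylv p q y = 0 -> y = 0) -> forall z, sylv q p z = 0 -> z = 0.
Proof.
move=> inj z; apply: contra_eq => z0; apply/eqP => qz.
suff /inj/eqP : sylv p q z^-1 = 0 by rewrite invr_eq0; apply/negP.
by rewrite sylv_inv ?unitqE // qz mulr0 mul0r.
Qed.

(** Inversion linearizes the quadratic equation, at the cost of exchanging p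
    and q. *)
Lemma quadratic_eq_inv (A : unitRingType) (p q u y : A) :
  y \is a GRing.unit ->
  (sylv p q y - y * u * y = 0) <-> (sylv q p y^-1 = u).
Proof.
move=> uy; rewrite sylv_inv //.
split=> [/eqP|<-]; last by rewrite !mulrA mulrV // mul1r divrK // subrr.
by rewrite subr_eq0 => /eqP ->; rewrite !mulrA mulVr // mul1r mulrK.
Qed.

Unset Implicit Arguments.

Theorem proposition31 (R : realType) (a b c d : quat R) (hb : b != 0)
    (l : quat R) (hl : left_eigenvalue (mx22 a b c d) l)
    (hrank : diff_rank (mu a b c d) l = 4%N) :
  ([set x : quat R | left_eigenvalue (mx22 a b c d) x] #= `I_2)%card.
Proof.
set p := (d - l) * b^-1; set q := b^-1 * (a - l).
have inj_dmu : forall y, sylv p q y = 0 -> y = 0.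
  move=> y /= h; apply: (endo_rank_inj hrank).
  by rewrite diff_mu.
have [z zE] : exists z, sylv q p z = b^-1.
  pose g : {linear 'rV[R]_4 -> 'rV[R]_4} :=
    (sylv q p : {linear quat R -> quat R}).
  exact: (@endo_inj_surj R 4 g (sylv_swap_inj inj_dmu) b^-1).
have z_uniq z' : sylv q p z' = b^-1 -> z' = z.
  rewrite -zE => /eqP; rewrite -subr_eq0 -linearB => /eqP.
  by move=> /(sylv_swap_inj inj_dmu)/eqP; rewrite subr_eq0 => /eqP.
have z0 : z != 0.
  apply: contraNneq hb => z0; rewrite -invr_eq0 -zE z0.
  by rewrite linear0.
have mul0 : mu a b c d l = 0 by apply/left_eigenvalue_mu.
have muE y : mu a b c d (y + l) = sylv p q y - y * b^-1 * y.
  by rewrite muD mul0 add0r.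
apply/eq_cardSP; exists l => //.
suff -> : [set x | left_eigenvalue (mx22 a b c d) x] `\ l = [set z^-1 + l].
  exact: card_set1.
apply/seteqP; split=> x /=.
  move=> [/(left_eigenvalue_mu a c d x hb) mux /eqP xl].
  have yl : x - l \is a GRing.unit by rewrite unitqE subr_eq0.
  rewrite -(subrK l x) muE in mux.
  by rewrite -(z_uniq _ ((quadratic_eq_inv p q b^-1 yl).1 mux)) invrK subrK.
move=> ->; split; last first.
  by move/eqP; rewrite -subr_eq0 addrK invr_eq0; apply/negP.
apply/left_eigenvalue_mu => //; rewrite muE; apply/quadratic_eq_inv.
  by rewrite unitqE invr_eq0.
by rewrite invrK.
Qed.
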